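(* Let $0\le a<b$ and let $f:[a,b]\to\mathbb{R}$, $[a,b]\subset[0,\infty)$, be a differentiable function on $(a,b)$ such that $f'\in L[a,b]$. Suppose that $|f'|$ is $s$-convex in the second sense on $[a,b]$ for some fixed $s\in(0,1]$, and that $|f'(x)|\le M$ for all $x\in[a,b]$. Then for every $\alpha>0$ and every $x\in[a,b]$, $$\left|\left(\frac{(x-a)^{\alpha}+(b-x)^{\alpha}}{b-a}\right)f(x)-\frac{\Gamma(\alpha+1)}{b-a}\left[J_{x-}^{\alpha}f(a)+J_{x+}^{\alpha}f(b)\right]\right|$$ $$\le\frac{M}{b-a}\left(1+\frac{\Gamma(\alpha+1)\Gamma(s+1)}{\Gamma(\alpha+s+1)}\right)\left[\frac{(x-a)^{\alpha+1}+(b-x)^{\alpha+1}}{\alpha+s+1}\right].$$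
   Context: $L[a,b]$ denotes the space of Lebesgue integrable functions on $[a,b]$. A function $g$ is $s$-convex in the second sense on $[a,b]\subset[0,\infty)$, where $s\in(0,1]$, if $g(\lambda u+(1-\lambda)v)\le\lambda^s g(u)+(1-\lambda)^s g(v)$ for all $u,v\in[a,b]$ and $\lambda\in[0,1]$. The hypotheses on $|f'|$ over the closed interval $[a,b]$ presuppose that $f'$ is defined at the endpoints, as the one-sided derivatives $f'(a)$ and $f'(b)$. $\Gamma(\alpha)=\int_0^\infty e^{-u}u^{\alpha-1}du$ is the Euler Gamma function. The Riemann-Liouville fractional integrals of order $\alpha>0$ appearing here are $J_{x-}^{\alpha}f(a)=\frac{1}{\Gamma(\alpha)}\int_a^x (t-a)^{\alpha-1}f(t)\,dt$ and $J_{x+}^{\alpha}f(b)=\frac{1}{\Gamma(\alpha)}\int_x^b (b-t)^{\alpha-1}f(t)\,dt$ (equal to $0$ when the interval of integration is degenerate). *)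

(* Defs.v *)
From mathcomp Require Import all_boot all_order all_algebra.
From mathcomp Require Import all_classical all_reals all_analysis.

Set Implicit Arguments.
Unset Strict Implicit.
Unset Printing Implicit Defensive.

Import Order.TTheory GRing.Theory Num.Theory.
Import numFieldNormedType.Exports.

Local Open Scope classical_set_scope.
Local Open Scope ring_scope.

(* Only meaningful for z > 0: the integral diverges otherwise, and Rintegral
   then returns a junk value. *)
Definition Gamma {R : realType} (z : R) : R :=
  \int[lebesgue_measure]_(u in `]0, +oo[) (expR (- u) * u `^ (z - 1)).

(* J_{c+}^alpha f (y), for c <= y. *)
Definition RL_left {R : realType} (alpha : R) (c : R) (f : R -> R) (y : R) : R :=
  (Gamma alpha)^-1 *
  \int[lebesgue_measure]_(t in `[c, y]) ((y - t) `^ (alpha - 1) * f t).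

(* J_{c-}^alpha f (y), for y <= c. *)
Definition RL_right {R : realType} (alpha : R) (c : R) (f : R -> R) (y : R) : R :=
  (Gamma alpha)^-1 *
  \int[lebesgue_measure]_(t in `[y, c]) ((t - y) `^ (alpha - 1) * f t).

Definition s_convex2 {R : realType} (s : R) (A : set R) (g : R -> R) : Prop :=
  forall u v lambda : R, A u -> A v -> 0 <= lambda <= 1 ->
    g (lambda * u + (1 - lambda) * v)
      <= lambda `^ s * g u + (1 - lambda) `^ s * g v.

(* A function on [a, b] is represented by a total function R -> R; the
   one-sided limits at a and b make its values outside [a, b] irrelevant. *)
Definition is_derivative_on {R : realType} (a b : R) (f f' : R -> R) : Prop :=
  [/\ forall x, x \in `]a, b[ -> is_derive x 1 f (f' x),
      (f t - f a) / (t - a) @[t --> a^'+] --> f' a &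
      (f t - f b) / (t - b) @[t --> b^'-] --> f' b].

(* Main.v *)
Require Import Defs.
From mathcomp Require Import all_boot all_order all_algebra.
From mathcomp Require Import all_classical all_reals all_analysis.
From mathcomp Require Import measurable_realfun ring lra.

Import Order.TTheory GRing.Theory Num.Theory.
Import numFieldNormedType.Exports.

Local Open Scope classical_set_scope.
Local Open Scope ring_scope.

(** Write w for the kernel (t - a)^(alpha-1) on [a, x], and similarly
    (b - t)^(alpha-1) on [x, b].  Since Gamma(alpha+1) = alpha Gamma(alpha),
    the factor Gamma(alpha+1) turns each fractional integral into alpha times
    the integral of w f, and since alpha times the integral of w over [a, x] is
    (x - a)^alpha, the left-hand side is, up to the factor 1/(b - a), the sum
    of alpha * int w(t) (f(x) - f(t)) dt over the two pieces.  The mean value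
    theorem bounds |f(x) - f(t)| by M |x - t|, and integrating powers gives

      |(x - a)^alpha f(x) - Gamma(alpha+1) J f(a)|
        <= M (x - a)^(alpha+1) / (alpha + 1)

    together with its mirror image ([RL_right_deviation_le],
    [RL_left_deviation_le]).

    It remains to compare constants ([Gamma_ratio_ge]):

      1 / (alpha + 1) <= (1 + Gamma(alpha+1) Gamma(s+1) / Gamma(alpha+s+1))
                         / (alpha + s + 1).

    Clearing denominators and using Gamma(s+1) = s Gamma(s), this says that
    Gamma(alpha+s+1) <= (alpha + 1) Gamma(alpha+1) Gamma(s).  Both facts needed
    for it, Gamma(alpha+s+1) <= (alpha + 1) Gamma(alpha+1) and 1 <= Gamma(s),
    follow from a single interpolation inequality ([Gamma_interpolation])

      Gamma(q + th) <= (1 - th) Gamma(q) + th Gamma(q + 1),   0 <= th <= 1,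

    which is the integrated form of the weighted arithmetic-geometric mean
    inequality u^th <= (1 - th) + th u.  (Analytically, the constant on the
    right is the integral of t^alpha (t^s + (1 - t)^s) over [0, 1], and
    t^s + (1 - t)^s >= 1; going through Gamma alone avoids the Beta integral.)

    The analytic work is in the improper integrals: the kernels are singular at
    an endpoint when alpha < 1, so antiderivatives are evaluated on compact
    subintervals and monotone convergence passes to the limit
    ([ge0_integral_cvg_exhaustion]). *)

(** * Improper integrals by exhaustion *)

(** Common source of the three improper integrals below: the two kernels, on a
    bounded open interval, and the Gamma integrand, on a half-line. *)
Lemma ge0_integral_cvg_exhaustion {R : realType} (I : interval R)
    (u v : nat -> R) (f : R -> R) :
  nonincreasing_seq u -> nondecreasing_seq v ->
  (\bigcup_n `[u n, v n]%classic = [set` I]) ->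
  (forall x, x \in I -> 0 <= f x) -> measurable_fun [set` I] f ->
  (\int[lebesgue_measure]_(x in `[u n, v n]) (f x)%:E)%E @[n --> \oo] -->
  (\int[lebesgue_measure]_(x in [set` I]) (f x)%:E)%E.
Proof.
move=> du iv uvI f0 mf.
have uvsub n : `[u n, v n]%classic `<=` [set` I].
  by rewrite -uvI => x nx; exists n.
rewrite -uvI; apply: ge0_nondecreasing_set_cvg_integral => //.
- move=> m n mn; rewrite subsetEset => x /=; rewrite !in_itv/= => /andP[ux xv].
  by rewrite (le_trans (du _ _ mn) ux) (le_trans xv (iv _ _ mn)).
- move=> n; apply/measurable_EFinP; exact: measurable_funS mf.
- by move=> n x /uvsub xI; rewrite lee_fin f0.
Qed.

(** Second fundamental theorem of calculus where the integrand only has to be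
    continuous inside the interval and may blow up at either end: its sign
    makes the integrals over [a + d n, b - d n] increase to the whole integral,
    and the one-sided continuity of F makes their values converge. *)
Lemma ge0_FTC2_oo {R : realType} (f F : R -> R) (a b : R) : a < b ->
  {in `]a, b[, forall x, 0 <= f x} ->
  {in `]a, b[, continuous f} ->
  derivable_oo_LRcontinuous F a b ->
  {in `]a, b[, F^`()%classic =1 f} ->
  (\int[lebesgue_measure]_(x in `[a, b]) (f x)%:E = (F b - F a)%:E)%E.
Proof.
move=> ab f0 cf [dF Fa Fb] F'f.
have mf : measurable_fun `]a, b[ f.
  by apply: open_continuous_measurable_fun => // x /set_mem; exact: cf.
(* [harmonic n.+1] is 1/(n+2), so that the subintervals are never degenerate. *)
pose d n : R := (b - a) / 2 * harmonic n.+1.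
have d_gt0 n : 0 < d n.
  by rewrite mulr_gt0 ?invr_gt0 ?ltr0n// divr_gt0 ?subr_gt0.
have d_lt n : d n < (b - a) / 2.
  by rewrite gtr_pMr ?divr_gt0 ?subr_gt0// invf_lt1 ?ltr1n ?ltr0n.
have d_noninc : nonincreasing_seq d.
  move=> m n mn; rewrite ler_pM2l ?divr_gt0 ?subr_gt0// lef_pV2 ?posrE ?ltr0n//.
  by rewrite ler_nat ltnS.
have d_cvg : d n @[n --> \oo] --> (0 : R).
  rewrite -(mulr0 ((b - a) / 2)); apply: cvgMr.
  by rewrite (cvg_shiftS (@harmonic R)); exact: cvg_harmonic.
pose u n := a + d n; pose v n := b - d n.
have uv_in n x : x \in `[u n, v n] -> x \in `]a, b[.
  rewrite !in_itv/= => /andP[ux xv]; move: (d_gt0 n) => d0.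
  by rewrite /u /v in ux xv; apply/andP; split; lra.
have int_n n : (\int[lebesgue_measure]_(x in `[u n, v n]) (f x)%:E =
    (F (v n) - F (u n))%:E)%E.
  have uv : u n < v n by move: (d_lt n); rewrite /u /v; lra.
  have cF : {within `[u n, v n], continuous F}.
    by apply: derivable_within_continuous => x /uv_in; exact: dF.
  have [_ Fu Fv] := (continuous_within_itvP _ uv).1 cF.
  rewrite EFinB; apply: continuous_FTC2 => //.
  - by apply: continuous_in_subspaceT => x /set_mem /uv_in; exact: cf.
  - by split => // x xuv; apply/dF/(uv_in n)/subset_itv_oo_cc.
  - by move=> x xuv; apply/F'f/(uv_in n)/subset_itv_oo_cc.
rewrite (integral_itv_bndoo true false); last exact/measurable_EFinP.
have : (\int[lebesgue_measure]_(x in `[u n, v n]) (f x)%:E)%E @[n --> \oo] -->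
    (\int[lebesgue_measure]_(x in `]a, b[) (f x)%:E)%E.
  apply: ge0_integral_cvg_exhaustion => //.
  - by move=> m n /d_noninc; rewrite /u lerD2l.
  - by move=> m n /d_noninc; rewrite /v lerD2l lerN2.
  apply/seteqP; split => [x [n _] /uv_in//|x /=].
  rewrite in_itv/= => /andP[ax xb].
  have m_gt0 : 0 < Num.min (x - a) (b - x) by rewrite lt_min !subr_gt0 ax.
  move/cvgr0_norm_le: (d_cvg) => /(_ _ m_gt0)[n _ /(_ n (leqnn n))].
  rewrite /= (ger0_norm (ltW (d_gt0 n))) le_min => /andP[dx dx'].
  by exists n => //=; rewrite in_itv/= /u /v; apply/andP; split; lra.
move/cvg_lim => <- //; apply/cvg_lim => //.
under eq_fun do rewrite int_n.
apply: cvg_EFin; first exact: nearW.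
apply: cvgB.
- apply: ((cvg_at_leftP F b (F b)).1 Fb); split.
  + by move=> n; rewrite /v gtrBl.
  + by rewrite -[X in _ --> X]subr0; apply: cvgB => //; exact: cvg_cst.
- apply: ((cvg_at_rightP F a (F a)).1 Fa); split.
  + by move=> n; rewrite /u ltrDl.
  + by rewrite -[X in _ --> X]addr0; apply: cvgD => //; exact: cvg_cst.
Qed.

(** * Integrals of the fractional kernels *)

Lemma is_derive_powR_comp {R : realType} (p e : R) (g : R -> R) (x : R) :
  0 < g x -> is_derive x 1 g e ->
  is_derive x 1 (fun t => g t `^ p) (p * g x `^ (p - 1) * e).
Proof. by move=> gx; exact: is_derive1_comp (is_derive1_powR p gx). Qed.

Lemma is_derive_continuous {R : realType} (f : R -> R) (x e : R) :
  is_derive x 1 f e -> {for x, continuous f}.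
Proof. by case=> df _; exact/differentiable_continuous/derivable1_diffP. Qed.

Lemma powR_comp_cvg0 {R : realType} (p : R) (u : nat -> R) : 0 < p ->
  (forall n, 0 < u n) -> u n @[n --> \oo] --> (0 : R) ->
  u n `^ p @[n --> \oo] --> (0 : R).
Proof.
by move=> p_gt0 u_gt0 u0; apply: (cvg_at_rightP _ _ _).1 (powR_cvg0 p_gt0) _ _.
Qed.

(** For p < 1 the integrand is unbounded near c, hence the improper form of the
    fundamental theorem. *)
Lemma integral_powR_subl {R : realType} (c d p : R) : c <= d -> 0 < p ->
  (\int[lebesgue_measure]_(t in `[c, d]) ((t - c) `^ (p - 1))%:E
   = ((d - c) `^ p / p)%:E)%E.
Proof.
rewrite le_eqVlt => /predU1P[->|cd] p_gt0.
  by rewrite set_itv1 integral_set1 subrr powR0 ?gt_eqF// mul0r.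
have dp q t : c < t ->
    is_derive t 1 (fun t => (t - c) `^ q) (q * (t - c) `^ (q - 1)).
  move=> ct; rewrite -[X in is_derive _ _ _ X]mulr1.
  apply: is_derive_powR_comp; first by rewrite subr_gt0.
  by rewrite -[X in is_derive _ _ _ X](subr0 1); exact: is_deriveB.
pose F t : R := p^-1 * (t - c) `^ p.
have dF t : c < t -> is_derive t 1 F ((t - c) `^ (p - 1)).
  move=> /(dp p) /(is_deriveZ p^-1).
  by rewrite /GRing.scale/= mulrA mulVf ?mul1r// gt_eqF.
have -> : (d - c) `^ p / p = F d - F c.
  by rewrite /F subrr powR0 ?gt_eqF// mulr0 subr0 mulrC.
apply: ge0_FTC2_oo => //.
- by move=> t _; exact: powR_ge0.
- move=> t; rewrite in_itv/= => /andP[ct _].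
  exact: is_derive_continuous (dp _ _ ct).
- split.
  + by move=> t; rewrite in_itv/= => /andP[/dF[]].
  + apply/cvg_at_rightP => u [uc ucvg]; rewrite /F subrr powR0 ?gt_eqF//.
    apply: cvgMr; apply: powR_comp_cvg0 => // [n|]; first by rewrite subr_gt0.
    by rewrite -(subrr c); apply: cvgB => //; exact: cvg_cst.
  + exact/cvg_at_left_filter/is_derive_continuous/dF.
- by move=> t; rewrite in_itv/= => /andP[/dF[_ <-] _]; rewrite derive1E.
Qed.

Lemma integral_powR_subr {R : realType} (c d p : R) : c <= d -> 0 < p ->
  (\int[lebesgue_measure]_(t in `[c, d]) ((d - t) `^ (p - 1))%:E
   = ((d - c) `^ p / p)%:E)%E.
Proof.
rewrite le_eqVlt => /predU1P[->|cd] p_gt0.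
  by rewrite set_itv1 integral_set1 subrr powR0 ?gt_eqF// mul0r.
have dp q t : t < d ->
    is_derive t 1 (fun t => (d - t) `^ q) (q * (d - t) `^ (q - 1) * -1).
  move=> td; apply: is_derive_powR_comp; first by rewrite subr_gt0.
  by rewrite -[X in is_derive _ _ _ X]sub0r; exact: is_deriveB.
pose F t : R := - p^-1 * (d - t) `^ p.
have dF t : t < d -> is_derive t 1 F ((d - t) `^ (p - 1)).
  move=> /(dp p) /(is_deriveZ (- p^-1)).
  by rewrite /GRing.scale/= mulrN1 mulrNN mulrA mulVf ?mul1r// gt_eqF.
have -> : (d - c) `^ p / p = F d - F c.
  by rewrite /F subrr powR0 ?gt_eqF// mulr0 sub0r mulNr opprK mulrC.
apply: ge0_FTC2_oo => //.
- by move=> t _; exact: powR_ge0.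
- move=> t; rewrite in_itv/= => /andP[_ td].
  exact: is_derive_continuous (dp _ _ td).
- split.
  + by move=> t; rewrite in_itv/= => /andP[_ /dF[]].
  + exact/cvg_at_right_filter/is_derive_continuous/dF.
  + apply/cvg_at_leftP => u [ud ucvg]; rewrite /F subrr powR0 ?gt_eqF//.
    apply: cvgMr; apply: powR_comp_cvg0 => // [n|]; first by rewrite subr_gt0.
    by rewrite -(subrr d); apply: cvgB => //; exact: cvg_cst.
- by move=> t; rewrite in_itv/= => /andP[_ /dF[_ <-]]; rewrite derive1E.
Qed.

(** * The Gamma function *)

Definition gamma_integrand {R : realType} (z u : R) : R :=
  expR (- u) * u `^ (z - 1).

(** Gamma before truncation to a real number.  In the extended reals the
    functional equation needs no prior knowledge of convergence, and
    convergence can then be deduced from it. *)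
Definition eGamma {R : realType} (z : R) : \bar R :=
  (\int[lebesgue_measure]_(u in `]0%R, +oo[) (gamma_integrand z u)%:E)%E.

Lemma GammaE {R : realType} (z : R) : Gamma z = fine (eGamma z).
Proof. by []. Qed.

Lemma gamma_integrand_ge0 {R : realType} (z u : R) : 0 <= gamma_integrand z u.
Proof. by rewrite mulr_ge0 ?expR_ge0 ?powR_ge0. Qed.

Lemma measurable_gamma_integrand {R : realType} (z : R) (D : set R) :
  measurable_fun D (gamma_integrand z).
Proof.
apply: (@measurable_funS _ _ _ _ setT) => //; apply: measurable_funM.
  by apply: measurableT_comp.
exact: measurable_powR.
Qed.

Lemma eGamma_ge0 {R : realType} (z : R) : (0 <= eGamma z)%E.
Proof. by apply: integral_ge0 => u _; rewrite lee_fin gamma_integrand_ge0. Qed.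

(** The Taylor bound u^(n+1) <= (n+1)! e^u, with one power of u kept aside to
    force decay at infinity. *)
Lemma powR_expRN_le {R : realType} (z u : R) (n : nat) : z <= n%:R -> 1 <= u ->
  expR (- u) * u `^ z <= (n.+1)`!%:R / u.
Proof.
move=> zn u1; have u0 : 0 < u by exact: lt_le_trans u1.
rewrite expRN mulrC ler_pdivrMr ?expR_gt0// mulrAC ler_pdivlMr//.
apply: (@le_trans _ _ (u ^+ n.+1)).
  by rewrite exprSr -powR_mulrn ?(ltW u0)// ler_wpM2r ?(ltW u0)// ler_powR.
rewrite mulrC -ler_pdivrMr ?ltr0n ?fact_gt0//.
by apply: le_trans (expR_ge1Dxn n (ltW u0)); rewrite lerDr.
Qed.

Lemma is_derive_expRN_powR {R : realType} (z u : R) : 0 < u ->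
  is_derive u 1 (fun x => expR (- x) * x `^ z)
    (z * gamma_integrand z u - gamma_integrand (z + 1) u).
Proof.
move=> u0.
have de : is_derive u 1 (fun x : R => expR (- x)) (expR (- u) * -1).
  apply: is_derive1_comp.
apply: is_derive_eq.
  apply: is_deriveM; exact: is_derive1_powR.
rewrite /GRing.scale/= /gamma_integrand addrK; ring.
Qed.

Lemma continuous_gamma_integrand {R : realType} (z u : R) : 0 < u ->
  {for u, continuous (gamma_integrand z)}.
Proof. by move=> /(is_derive_expRN_powR (z - 1))/is_derive_continuous. Qed.

(** Integration by parts on a compact interval away from the singularity at 0,
    keeping the boundary terms. *)
Lemma integral_gamma_parts {R : realType} (z a b : R) : 0 < a -> a < b ->
  (z%:E * \int[lebesgue_measure]_(u in `[a, b]) (gamma_integrand z u)%:E =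
   \int[lebesgue_measure]_(u in `[a, b]) (gamma_integrand (z + 1) u)%:E
   + (expR (- b) * b `^ z - expR (- a) * a `^ z)%:E)%E.
Proof.
move=> a0 ab.
have in_gt0 x : x \in `[a, b] -> 0 < x.
  by rewrite in_itv/= => /andP[ax _]; exact: lt_le_trans ax.
have cg w : {within `[a, b], continuous (gamma_integrand w)}.
  apply: continuous_in_subspaceT => x /set_mem /in_gt0.
  exact: continuous_gamma_integrand.
have ig w :
    (@lebesgue_measure R).-integrable `[a, b] (EFin \o gamma_integrand w).
  by apply: continuous_compact_integrable (cg w); exact: segment_compact.
pose H x : R := expR (- x) * x `^ z.
have dH x : x \in `[a, b] -> is_derive x 1 H _ :=
  fun xab => is_derive_expRN_powR z x (in_gt0 _ xab).
have cH : {within `[a, b], continuous H}.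
  by apply: derivable_within_continuous => x /dH[].
have [_ Ha Hb] := (continuous_within_itvP _ ab).1 cH.
have : (\int[lebesgue_measure]_(u in `[a, b])
    ((z * gamma_integrand z u)%:E - (gamma_integrand (z + 1) u)%:E)
    = (H b)%:E - (H a)%:E)%E.
  apply: (continuous_FTC2 ab (F := H)
    (f := fun u => z * gamma_integrand z u - gamma_integrand (z + 1) u)).
  - apply: continuous_in_subspaceT => x /set_mem /in_gt0 x0.
    by apply: cvgB; [apply: cvgMr|]; exact: continuous_gamma_integrand.
  - by split => // x xab; have [] := dH x (subset_itv_oo_cc xab).
  - by move=> x xab; rewrite derive1E; have [] := dH x (subset_itv_oo_cc xab).
rewrite integralB_EFin//; last exact: (integrableZl _ z (ig z)).
under eq_integral do rewrite EFinM.
rewrite integralZl//; last exact: ig.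
have Kfin w : (\int[lebesgue_measure]_(u in `[a, b]) (gamma_integrand w u)%:E)%E
    \is a fin_num by apply: integrable_fin_num => //; exact: ig.
rewrite -(fineK (Kfin z)) -(fineK (Kfin (z + 1))) => /(congr1 fine)/= FTC.
by rewrite -EFinM -EFinD; congr EFin; rewrite /H in FTC; lra.
Qed.

(** Limit of [integral_gamma_parts] along the intervals [1/(n+2), n+2]: the
    boundary terms vanish, at 0 because z > 0 and at infinity by the Taylor
    bound. *)
Lemma eGammaD1 {R : realType} (z : R) : 0 < z ->
  (z%:E * eGamma z = eGamma (z + 1))%E.
Proof.
move=> z_gt0.
pose u n : R := harmonic n.+1; pose v n : R := n.+2%:R.
have u_gt0 n : 0 < u n by rewrite invr_gt0 ltr0n.
have v_gt0 n : 0 < v n by rewrite ltr0n.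
have v_ge1 n : 1 <= v n by rewrite ler1n.
have uv n : u n < v n.
  by rewrite (@lt_le_trans _ _ 1)// invf_lt1 ?ltr1n// ltr0n.
have u0 : u n @[n --> \oo] --> (0 : R).
  by rewrite (cvg_shiftS (@harmonic R)); exact: cvg_harmonic.
have cvgI w :
    (\int[lebesgue_measure]_(x in `[u n, v n]) (gamma_integrand w x)%:E)%E
    @[n --> \oo] --> eGamma w.
  apply: ge0_integral_cvg_exhaustion => //.
  - by move=> m n mn; rewrite lef_pV2 ?posrE ?ltr0n// ler_nat ltnS.
  - by move=> m n mn; rewrite ler_nat !ltnS.
  - apply/seteqP; split => [x [n _]/=|x /=]; rewrite !in_itv/= andbT.
      by move=> /andP[ux _]; exact: lt_le_trans ux.
    move=> x_gt0.
    have [n _ un] : \forall n \near \oo, `|u n| <= x.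
      by move/cvgr0_norm_le : (u0); exact.
    exists (maxn n (Num.truncn x)) => //=; rewrite in_itv/=.
    rewrite -[u _]ger0_norm ?(ltW (u_gt0 _))// un/= ?leq_maxl//.
    rewrite ltW// (lt_le_trans (truncnS_gt x))// ler_nat ltnS.
    by rewrite (leq_trans (leq_maxr n _)).
  - by move=> x _; exact: gamma_integrand_ge0.
  - exact: measurable_gamma_integrand.
have bnd0 : (expR (- v n) * v n `^ z - expR (- u n) * u n `^ z) @[n --> \oo]
    --> (0 : R).
  rewrite -(subr0 0); apply: cvgB.
    pose k := (Num.truncn z).+1.
    apply: (@squeeze_cvgr _ _ _ _ (cst 0) (fun n => (k.+1)`!%:R * u n)).
    - apply: nearW => n /=; rewrite mulr_ge0 ?expR_ge0 ?powR_ge0//=.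
      by apply: powR_expRN_le => //; rewrite ltW// truncnS_gt.
    - exact: cvg_cst.
    - by rewrite -(mulr0 (k.+1)`!%:R); apply: cvgMr.
  apply: (@squeeze_cvgr _ _ _ _ (cst 0) (fun n => u n `^ z)).
  - apply: nearW => n /=; rewrite mulr_ge0 ?expR_ge0 ?powR_ge0//=.
    by rewrite ler_piMl ?powR_ge0// expR_le1 oppr_le0 ltW.
  - exact: cvg_cst.
  - exact: powR_comp_cvg0.
have cvgl : (z%:E * \int[lebesgue_measure]_(x in `[u n, v n])
    (gamma_integrand z x)%:E)%E @[n --> \oo] --> (z%:E * eGamma z)%E.
  by apply: cvgeZl.
have cvgr : (z%:E * \int[lebesgue_measure]_(x in `[u n, v n])
    (gamma_integrand z x)%:E)%E @[n --> \oo] --> (eGamma (z + 1) + 0%:E)%E.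
  under eq_fun do rewrite integral_gamma_parts//.
  apply: cvgeD => //; first exact: fin_num_adde_defl.
  by apply: cvg_EFin => //; exact: nearW.
by rewrite -(adde0 (eGamma (z + 1))); exact: cvg_unique cvgl cvgr.
Qed.

Lemma eGamma1 {R : realType} : eGamma (1 : R) = 1%E.
Proof.
rewrite /eGamma integral_itv_obnd_cbnd; last first.
  apply/measurable_EFinP; exact: measurable_gamma_integrand.
under eq_integral do rewrite /gamma_integrand subrr powRr0 mulr1.
have dF (x : R) : is_derive x 1 (fun x : R => - expR (- x)) (expR (- x)).
  have de : is_derive x 1 (fun x : R => expR (- x)) (expR (- x) * -1).
    exact: is_derive1_comp.
  by have := is_deriveN de; rewrite mulrN1 opprK.
rewrite (@ge0_continuous_FTC2y _ _ (fun x => - expR (- x)) 0 0).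
- by rewrite oppr0 expR0 -EFinB sub0r opprK.
- by move=> x _; exact: expR_ge0.
- apply: continuous_subspaceT => x; apply: continuous_comp.
    exact: opp_continuous.
  exact: continuous_expR.
- rewrite -[X in _ --> X]oppr0; apply: cvgN; exact: cvgr_expR.
- by move=> x _; have [] := dF x.
- by apply: cvg_at_right_filter; exact: is_derive_continuous (dF 0).
- by move=> x _; rewrite derive1E; have [] := dF x.
Qed.

(** The functional equation gives finiteness at the positive integers, from
    [eGamma1].  Since u^z <= 1 + u^n for z <= n, eGamma (z + 1) is finite for
    every z > 0, and dividing by z brings finiteness down to z itself, without
    a separate study of the singularity at 0. *)
Lemma eGamma_lty {R : realType} (z : R) : 0 < z -> (eGamma z < +oo)%E.
Proof.
move=> z_gt0.
have eGn n : (eGamma (n.+1%:R : R) < +oo)%E.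
  elim: n => [|n IH]; first by rewrite eGamma1 ltry.
  rewrite -natr1 -eGammaD1 ?ltr0n// -[eGamma _]fineK ?ltry//.
  by rewrite ge0_fin_numE ?eGamma_ge0.
suff eG1 : (eGamma (z + 1) < +oo)%E.
  move: eG1; rewrite -eGammaD1//.
  case: (eGamma z) (eGamma_ge0 z) => [r _ _|_|//].
    by rewrite ltry.
  by rewrite mulry gtr0_sg// mul1e.
pose n := (Num.truncn z).+1.
have zn : z <= n%:R by rewrite ltW// truncnS_gt.
apply: (@le_lt_trans _ _ (eGamma (1 : R) + eGamma (n.+1%:R : R))%E); last first.
  by rewrite lte_add_pinfty// -?(natr1 R 0) eGamma1 ltry.
rewrite -ge0_integralD//=.
- apply: ge0_le_integral => //=.
  + by move=> u _; rewrite lee_fin gamma_integrand_ge0.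
  + apply/measurable_EFinP; exact: measurable_gamma_integrand.
  + by apply: emeasurable_funD; apply/measurable_EFinP;
      exact: measurable_gamma_integrand.
  + move=> u; rewrite in_itv/= andbT => u0.
    rewrite -EFinD lee_fin -mulrDr ler_wpM2l ?expR_ge0// subrr powRr0 addrK.
    rewrite -natr1 addrK; have [u1|/ltW u1] := leP u 1.
      apply: (@le_trans _ _ (1 `^ z)); last by rewrite powR1 lerDl powR_ge0.
      by rewrite ge0_ler_powR ?nnegrE// ltW.
    by rewrite (@le_trans _ _ (u `^ n%:R)) ?ler_powR// lerDr.
- by move=> u _; rewrite lee_fin gamma_integrand_ge0.
- apply/measurable_EFinP; exact: measurable_gamma_integrand.
- by move=> u _; rewrite lee_fin gamma_integrand_ge0.
- apply/measurable_EFinP; exact: measurable_gamma_integrand.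
Qed.

Lemma integrable_gamma_integrand {R : realType} (z : R) : 0 < z ->
  (@lebesgue_measure R).-integrable `]0%R, +oo[ (EFin \o gamma_integrand z).
Proof.
move=> z_gt0; apply/integrableP; split.
  apply/measurable_EFinP; exact: measurable_gamma_integrand.
under eq_integral do rewrite /= ger0_norm ?gamma_integrand_ge0//.
exact: eGamma_lty.
Qed.

Lemma Gamma1 {R : realType} : Gamma (1 : R) = 1.
Proof. by rewrite GammaE eGamma1. Qed.

Lemma Gamma_ge0 {R : realType} (z : R) : 0 <= Gamma z.
Proof. by rewrite GammaE fine_ge0// eGamma_ge0. Qed.

Lemma GammaD1 {R : realType} (z : R) : 0 < z -> Gamma (z + 1) = z * Gamma z.
Proof.
move=> z_gt0; rewrite !GammaE -eGammaD1// fineM//.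
by rewrite ge0_fin_numE ?eGamma_ge0 ?eGamma_lty.
Qed.

(** Weighted arithmetic-geometric mean inequality for 1 and u, multiplied by
    u^q. *)
Lemma powR_interpolation {R : realType} (u q th : R) : 0 < u -> 0 <= th <= 1 ->
  u `^ (q + th) <= (1 - th) * u `^ q + th * u `^ (q + 1).
Proof.
move=> u0 /andP[th0 th1].
(* With u^(q+th) factored out, the inequality is Jensen's inequality for the
   exponential at two points of weighted mean 0, that is the weighted sum of
   two tangent inequalities 1 + x <= e^x. *)
have powE w : u `^ w = u `^ (q + th) * expR ((w - (q + th)) * ln u).
  by rewrite /powR gt_eqF// -expRD; congr expR; ring.
rewrite (powE q) (powE (q + 1)) -[leLHS]mulr1.
rewrite 2!(mulrCA _ (u `^ (q + th))) -mulrDr ler_wpM2l ?powR_ge0//.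
have e1 := expR_ge1Dx ((q - (q + th)) * ln u).
have e2 := expR_ge1Dx ((q + 1 - (q + th)) * ln u).
have := ler_wpM2l th0 e2; have := ler_wpM2l (_ : 0 <= 1 - th) e1.
rewrite subr_ge0 => /(_ th1) h1 h2.
apply: le_trans (lerD h1 h2); rewrite le_eqVlt; apply/orP; left.
by apply/eqP; ring.
Qed.

Lemma Gamma_interpolation {R : realType} (q th : R) : 0 < q -> 0 <= th <= 1 ->
  Gamma (q + th) <= (1 - th) * Gamma q + th * Gamma (q + 1).
Proof.
move=> q0 th01; have /andP[th0 th1] := th01.
have i0 := integrable_gamma_integrand q q0.
have i1 : (@lebesgue_measure R).-integrable `]0%R, +oo[
  (EFin \o gamma_integrand (q + 1)).
  by apply: integrable_gamma_integrand; rewrite addr_gt0.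
rewrite /Gamma -(RintegralZl _ _ i0)// -(RintegralZl _ _ i1)//.
rewrite -RintegralD//; last 2 first.
- exact: (integrableZl _ _ i0).
- exact: (integrableZl _ _ i1).
apply: le_Rintegral => //.
- by apply: integrable_gamma_integrand; rewrite ltr_pwDl.
- by apply: (integrableD _ (integrableZl _ _ i0) (integrableZl _ _ i1)).
move=> u; rewrite /= in_itv/= andbT => u0; rewrite /gamma_integrand.
rewrite 2!(mulrCA _ (expR (- u))) -mulrDr ler_wpM2l ?expR_ge0//.
rewrite !(addrAC q _ (-1)); exact: powR_interpolation.
Qed.

(** Interpolation at 1 = s + (1 - s) gives
    1 = Gamma(1) <= s Gamma(s) + (1 - s) s Gamma(s)
      = (1 - (1 - s)^2) Gamma(s). *)
Lemma Gamma_ge1 {R : realType} (s : R) : 0 < s <= 1 -> 1 <= Gamma s.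
Proof.
move=> /andP[s0 s1].
have := Gamma_interpolation s (1 - s) s0.
rewrite subr_ge0 s1 gerBl ltW// => /(_ isT).
rewrite addrCA subrr addr0 Gamma1 GammaD1// => /le_trans; apply.
rewrite -subr_ge0.
rewrite (_ : _ - _ = (1 - s) ^+ 2 * Gamma s); last by ring.
by rewrite mulr_ge0 ?sqr_ge0 ?Gamma_ge0.
Qed.

(** On ]0, 1] this is [Gamma_ge1]; the functional equation propagates it. *)
Lemma Gamma_gt0 {R : realType} (z : R) : 0 < z -> 0 < Gamma z.
Proof.
move=> z0.
have [n zn] : exists n, z <= n.+1%:R :> R.
  by exists (Num.truncn z); rewrite ltW// truncnS_gt.
elim: n z z0 zn => [|n IH] z z0 zn.
  by apply: (lt_le_trans ltr01); apply: Gamma_ge1; rewrite z0.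
have [z1|z1] := leP z 1.
  by apply: (lt_le_trans ltr01); apply: Gamma_ge1; rewrite z0.
rewrite -(subrK 1 z) GammaD1 ?subr_gt0// mulr_gt0 ?subr_gt0//.
by apply: IH; rewrite ?subr_gt0// lerBlDr natr1.
Qed.

(** The comparison of constants: the left-hand side is what a Lipschitz bound on
    f yields, the right-hand side what the fractional Ostrowski inequality
    asserts. *)
Lemma Gamma_ratio_ge {R : realType} (al s : R) : 0 < al -> 0 < s <= 1 ->
  (al + 1)^-1 <=
  (1 + Gamma (al + 1) * Gamma (s + 1) / Gamma (al + s + 1)) / (al + s + 1).
Proof.
move=> al0 /andP[s0 s1].
have al1 : 0 < al + 1 by rewrite addr_gt0.
have als1 : 0 < al + s + 1 by rewrite !addr_gt0.
have s01 : 0 <= s <= 1 by rewrite (ltW s0) s1.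
have interp := Gamma_interpolation (al + 1) s al1 s01.
have Gs1 : 1 <= Gamma s by apply: Gamma_ge1; rewrite s0 s1.
move: (Gamma_gt0 _ als1) (Gamma_gt0 _ al1) interp Gs1.
rewrite [al + 1 + s]addrAC (GammaD1 _ al1) (GammaD1 _ s0).
move: (Gamma (al + s + 1)) (Gamma (al + 1)) (Gamma s) => H G S H0 G0 interp S1.
have HG : H <= (al + 1) * G.
  apply: le_trans interp _; rewrite -subr_ge0.
  (* the interpolation bound is (1 - s) G + s (al + 1) G *)
  rewrite (_ : _ - _ = al * (1 - s) * G); last by ring.
  by rewrite !mulr_ge0 ?subr_ge0// ltW.
rewrite -[leLHS]mul1r ler_pdivlMr// mulrAC ler_pdivrMr// mul1r.
suff : s <= G * (s * S) / H * (al + 1) by lra.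
rewrite mulrAC ler_pdivlMr//.
apply: le_trans (ler_wpM2l (ltW s0) HG) _; rewrite -subr_ge0.
rewrite (_ : _ - _ = s * (al + 1) * G * (S - 1)); last by ring.
by rewrite mulr_ge0 ?subr_ge0// !mulr_ge0// ltW.
Qed.

(** * Lipschitz bound from a bounded derivative *)

(** At the endpoints, f t is f a plus the difference quotient, which converges,
    times t - a, which tends to 0. *)
Lemma is_derivative_on_continuous {R : realType} (a b : R) (f f' : R -> R) :
  a < b -> is_derivative_on a b f f' -> {within `[a, b], continuous f}.
Proof.
move=> ab [df fa fb]; apply/(continuous_within_itvP _ ab); split.
- by move=> x /df dfx; exact: is_derive_continuous dfx.
- have : f a + (f t - f a) / (t - a) * (t - a) @[t --> a^'+] --> f a + f' a * 0.
    apply: cvgD; first exact: cvg_cst.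
    apply: cvgM => //; rewrite -(subrr a); apply: cvgB; last exact: cvg_cst.
    exact: cvg_at_right_filter.
  rewrite mulr0 addr0; apply: cvg_trans; apply: near_eq_cvg.
  near=> t; rewrite divfK ?subr_eq0 ?gt_eqF// ?subrKC//.
- have : f b + (f t - f b) / (t - b) * (t - b) @[t --> b^'-] --> f b + f' b * 0.
    apply: cvgD; first exact: cvg_cst.
    apply: cvgM => //; rewrite -(subrr b); apply: cvgB; last exact: cvg_cst.
    exact: cvg_at_left_filter.
  rewrite mulr0 addr0; apply: cvg_trans; apply: near_eq_cvg.
  near=> t; rewrite divfK ?subr_eq0 ?lt_eqF// ?subrKC//.
Unshelve. all: end_near. Qed.

Lemma is_derivative_on_lipschitz {R : realType} (a b M : R) (f f' : R -> R) :
  a < b -> is_derivative_on a b f f' ->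
  (forall x, x \in `[a, b] -> `|f' x| <= M) ->
  {in `[a, b] &, forall x y, `|f x - f y| <= M * `|x - y|}.
Proof.
move=> ab df bnd x y xab yab.
wlog yx : x y xab yab / y <= x.
  move=> H; have [yx|/ltW xy] := leP y x; first exact: H.
  by rewrite distrC (distrC x); exact: H.
have cf := is_derivative_on_continuous _ _ _ _ ab df.
have [df' _ _] := df.
move: xab yab; rewrite !in_itv/= => /andP[ax xb] /andP[ay yb].
have dfyx t : t \in `]y, x[ -> is_derive t 1 f (f' t).
  rewrite in_itv/= => /andP[yt tx]; apply: df'; rewrite in_itv/=.
  by rewrite (le_lt_trans ay yt) (lt_le_trans tx xb).
have cfyx : {within `[y, x], continuous f}.
  apply: continuous_subspaceW cf => t /=; rewrite !in_itv/= => /andP[yt tx].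
  by rewrite (le_trans ay yt) (le_trans tx xb).
have [z + fxy] := MVT_segment yx dfyx cfyx.
rewrite in_itv/= => /andP[yz zx].
rewrite fxy normrM ler_wpM2r// bnd// in_itv/=.
by rewrite (le_trans ay yz) (le_trans zx xb).
Qed.

(** * Deviation of a function from its weighted averages *)

(** The left-hand side is the modulus of the integral of w (y - f). *)
Lemma weighted_deviation_le {d : measure_display} {T : measurableType d}
    {R : realType} (mu : {measure set T -> \bar R}) (D : set T)
    (w f h : T -> R) (y : R) :
  measurable D -> measurable_fun D f ->
  (forall t, D t -> 0 <= w t) -> (forall t, D t -> `|y - f t| <= h t) ->
  mu.-integrable D (EFin \o w) ->
  mu.-integrable D (EFin \o (fun t => w t * h t)) ->
  `|y * (\int[mu]_(t in D) w t) - \int[mu]_(t in D) (w t * f t)|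
  <= \int[mu]_(t in D) (w t * h t).
Proof.
move=> mD mf w0 fh iw iwh.
have mw : measurable_fun D w.
  by apply/measurable_EFinP; exact: measurable_int iw.
pose g t := w t * (y - f t).
have gle t : D t -> `|g t| <= w t * h t.
  by move=> Dt; rewrite normrM ger0_norm ?w0// ler_wpM2l ?w0//; exact: fh.
have ig : mu.-integrable D (EFin \o g).
  apply: le_integrable iwh => //.
    apply/measurable_EFinP; apply: measurable_funM => //.
    exact: measurable_funB.
  move=> t Dt; rewrite lee_fin; apply: le_trans (gle _ Dt) _; exact: ler_norm.
have iyw : mu.-integrable D (EFin \o (fun t => y * w t)).
  exact: (integrableZl _ y iw).
have -> : y * (\int[mu]_(t in D) w t) - \int[mu]_(t in D) (w t * f t)
    = \int[mu]_(t in D) g t.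
  have -> : \int[mu]_(t in D) (w t * f t) = \int[mu]_(t in D) (y * w t - g t).
    by apply: eq_Rintegral => t _; rewrite /g; ring.
  by rewrite RintegralB// RintegralZl// subKr.
apply: le_trans (le_normr_Rintegral mD ig) _.
by apply: le_Rintegral => //; exact: integrable_norm ig.
Qed.

(** Common form of the left and right estimates: k is the distance to the far
    end of an interval of length L, whose near end is p, so that |p - t| is
    L - k t.  The weight k^(al-1) times L - k t is L k^(al-1) - k^al, which
    integrates to L^(al+1) (1/al - 1/(al+1)); this is where the constant
    1/(al+1) comes from. *)
Lemma powR_weighted_deviation_le {R : realType} (D : set R) (k f : R -> R)
    (p L M al : R) :
  0 < al -> 0 <= L -> measurable D ->
  measurable_fun D f -> measurable_fun D k ->
  (forall t, D t -> 0 <= k t) -> (forall t, D t -> `|p - t| = L - k t) ->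
  (forall t, D t -> `|f p - f t| <= M * `|p - t|) ->
  (forall q : R, 0 < q ->
    (\int[lebesgue_measure]_(t in D) (k t `^ (q - 1))%:E = (L `^ q / q)%:E)%E) ->
  `|L `^ al * f p - al * \int[lebesgue_measure]_(t in D) (k t `^ (al - 1) * f t)|
  <= M * (L `^ (al + 1) / (al + 1)).
Proof.
move=> al0 L0 mD mf mk k0 kL fM kint.
have al1 : 0 < al + 1 by rewrite addr_gt0.
have ik q : 0 < q ->
    (@lebesgue_measure R).-integrable D (EFin \o (fun t => k t `^ (q - 1))).
  move=> q0; apply/integrableP; split.
    apply/measurable_EFinP; apply: (measurableT_comp (measurable_powR _) mk).
  under eq_integral do rewrite /= ger0_norm ?powR_ge0//.
  by rewrite kint// ltry.
have Rk q : 0 < q ->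
    \int[lebesgue_measure]_(t in D) (k t `^ (q - 1)) = L `^ q / q.
  by move=> q0; rewrite /Rintegral kint.
have wdE t : D t -> k t `^ (al - 1) * `|p - t|
    = L * k t `^ (al - 1) - k t `^ (al + 1 - 1).
  move=> Dt; rewrite kL// addrK mulrBr mulrC; congr (_ - _).
  by rewrite mulrC mulr_powRB1// k0.
have iL : (@lebesgue_measure R).-integrable D
    (EFin \o (fun t => L * k t `^ (al - 1))).
  exact: (integrableZl _ L (ik _ al0)).
have iwd : (@lebesgue_measure R).-integrable D
    (EFin \o (fun t => k t `^ (al - 1) * `|p - t|)).
  apply: eq_integrable (integrableB _ iL (ik _ al1)) => //.
  by move=> t /set_mem Dt; rewrite /= wdE.
have iwM : (@lebesgue_measure R).-integrable D
    (EFin \o (fun t => k t `^ (al - 1) * (M * `|p - t|))).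
  apply: eq_integrable (integrableZl _ M iwd) => //.
  by move=> t _; rewrite /= -EFinM mulrCA.
have := weighted_deviation_le (@lebesgue_measure R) _ _ _ _ _ mD mf
  (fun t _ => powR_ge0 _ _) fM (ik _ al0) iwM.
rewrite Rk//.
have -> : \int[lebesgue_measure]_(t in D) (k t `^ (al - 1) * (M * `|p - t|))
    = M * (L `^ (al + 1) / (al * (al + 1))).
  under eq_Rintegral do rewrite mulrCA.
  rewrite RintegralZl//; congr (_ * _).
  under eq_Rintegral => t /set_mem Dt do rewrite wdE//.
  rewrite RintegralB//; last exact: ik.
  rewrite RintegralZl//; last exact: ik.
  rewrite !Rk// -(mulr_powRB1 L0 al1) addrK.
  by field; rewrite !gt_eqF.
have alE I : L `^ al * f p - al * I = al * (f p * (L `^ al / al) - I).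
  by field; rewrite gt_eqF.
move=> h; rewrite alE.
rewrite normrM gtr0_norm//; apply: le_trans (ler_wpM2l (ltW al0) h) _.
rewrite le_eqVlt; apply/orP; left; apply/eqP; field.
by rewrite !gt_eqF.
Qed.

(** * The fractional Ostrowski inequality *)

Lemma RL_right_deviation_le {R : realType} (f : R -> R) (y c M al : R) :
  0 < al -> y <= c -> measurable_fun `[y, c] f ->
  (forall t, t \in `[y, c] -> `|f c - f t| <= M * `|c - t|) ->
  `|(c - y) `^ al * f c - Gamma (al + 1) * RL_right al c f y|
  <= M * ((c - y) `^ (al + 1) / (al + 1)).
Proof.
move=> al0 yc mf fM; rewrite /RL_right (GammaD1 _ al0).
move: (Gamma al) (Gamma_gt0 _ al0) => G G0.
rewrite (mulrA (al * G)) mulfK ?gt_eqF//.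
apply: (powR_weighted_deviation_le `[y, c]%classic (fun t => t - y)) => //.
- by rewrite subr_ge0.
- exact: measurable_funB.
- by move=> t; rewrite /= in_itv/= subr_ge0 => /andP[].
- move=> t; rewrite /= in_itv/= => /andP[_ tc].
  by rewrite ger0_norm ?subr_ge0//; ring.
- by move=> q q0; exact: integral_powR_subl.
Qed.

Lemma RL_left_deviation_le {R : realType} (f : R -> R) (c y M al : R) :
  0 < al -> c <= y -> measurable_fun `[c, y] f ->
  (forall t, t \in `[c, y] -> `|f c - f t| <= M * `|c - t|) ->
  `|(y - c) `^ al * f c - Gamma (al + 1) * RL_left al c f y|
  <= M * ((y - c) `^ (al + 1) / (al + 1)).
Proof.
move=> al0 cy mf fM; rewrite /RL_left (GammaD1 _ al0).
move: (Gamma al) (Gamma_gt0 _ al0) => G G0.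
rewrite (mulrA (al * G)) mulfK ?gt_eqF//.
apply: (powR_weighted_deviation_le `[c, y]%classic (fun t => y - t)) => //.
- by rewrite subr_ge0.
- exact: measurable_funB.
- by move=> t; rewrite /= in_itv/= subr_ge0 => /andP[].
- move=> t; rewrite /= in_itv/= => /andP[ct _].
  by rewrite ler0_norm ?subr_le0//; ring.
- by move=> q q0; exact: integral_powR_subr.
Qed.

Theorem theorem7 (R : realType) (a b : R) (f f' : R -> R) (s M : R)
  (a_ge0 : 0 <= a) (ltab : a < b)
  (df : is_derivative_on a b f f')
  (intf' : (@lebesgue_measure R).-integrable `[a, b] (EFin \o f'))
  (s_gt0 : 0 < s) (s_le1 : s <= 1)
  (cvxf' : s_convex2 s `[a, b] (fun x => `|f' x|))
  (bndf' : forall x, x \in `[a, b] -> `|f' x| <= M)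
  (alpha : R) (alpha_gt0 : 0 < alpha) (x : R) (xab : x \in `[a, b]) :
  `| ((x - a) `^ alpha + (b - x) `^ alpha) / (b - a) * f x
     - Gamma (alpha + 1) / (b - a)
       * (RL_right alpha x f a + RL_left alpha x f b) |
  <= M / (b - a)
     * (1 + Gamma (alpha + 1) * Gamma (s + 1) / Gamma (alpha + s + 1))
     * (((x - a) `^ (alpha + 1) + (b - x) `^ (alpha + 1)) / (alpha + s + 1)).
Proof.
have lip := is_derivative_on_lipschitz _ _ _ _ _ ltab df bndf'.
have cf := is_derivative_on_continuous _ _ _ _ ltab df.
have mf : measurable_fun `[a, b] f by exact: subspace_continuous_measurable_fun.
have M_ge0 : 0 <= M.
  by rewrite (le_trans (normr_ge0 _) (bndf' _ xab)).
have /andP[ax xb] : a <= x <= b by rewrite in_itv in xab.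
have sub_l : `[a, x]%classic `<=` `[a, b]%classic.
  by move=> t /=; rewrite !in_itv/= => /andP[-> /le_trans]; exact.
have sub_r : `[x, b]%classic `<=` `[a, b]%classic.
  by move=> t /=; rewrite !in_itv/= => /andP[/(le_trans ax)-> ->].
have Hr := RL_right_deviation_le f a x M alpha alpha_gt0 ax
  (measurable_funS (measurable_itv _) sub_l mf)
  (fun t ht => lip _ _ xab (sub_l _ ht)).
have Hl := RL_left_deviation_le f x b M alpha alpha_gt0 xb
  (measurable_funS (measurable_itv _) sub_r mf)
  (fun t ht => lip _ _ xab (sub_r _ ht)).
have s01 : 0 < s <= 1 by rewrite s_gt0.
have HG := Gamma_ratio_ge alpha s alpha_gt0 s01.
have ba : 0 < b - a by rewrite subr_gt0.
have : 0 <= (x - a) `^ (alpha + 1) + (b - x) `^ (alpha + 1).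
  by rewrite addr_ge0// powR_ge0.
move: Hr Hl HG.
move: (RL_right alpha x f a) (RL_left alpha x f b) => Jr Jl.
move: (Gamma (alpha + 1) * Gamma (s + 1) / Gamma (alpha + s + 1)) => C.
move: (Gamma (alpha + 1)) => G.
move: ((x - a) `^ alpha) ((b - x) `^ alpha).
move: ((x - a) `^ (alpha + 1)) ((b - x) `^ (alpha + 1)).
move=> X1 Y1 X Y Hr Hl HG XY1.
have -> : (X + Y) / (b - a) * f x - G / (b - a) * (Jr + Jl)
  = ((X * f x - G * Jr) + (Y * f x - G * Jl)) / (b - a) by ring.
rewrite normrM [`|(b - a)^-1|]gtr0_norm ?invr_gt0//.
have -> : M / (b - a) * (1 + C) * ((X1 + Y1) / (alpha + s + 1))
  = M * ((X1 + Y1) * ((1 + C) / (alpha + s + 1))) / (b - a) by ring.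
rewrite ler_pM2r ?invr_gt0//.
apply: le_trans (ler_normD _ _) _; apply: le_trans (lerD Hr Hl) _.
by rewrite -mulrDr -mulrDl ler_wpM2l// ler_wpM2l.
Qed.
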